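(* There are absolute constants $c_1>0$ and $c_2>0$ such that for every integer $k\geq 1$, with $n:=2^k$, each of the Rudin-Shapiro polynomials $P_k$ and $Q_k$ (of degree $n-1$) has at least $c_2n$ zeros in the annulus $$\left\{z\in\mathbb{C}:1-\frac{c_1}{n}<|z|<1+\frac{c_1}{n}\right\}.$$
   Context: The Rudin-Shapiro polynomials are defined recursively by $P_0(z):=1$, $Q_0(z):=1$, and $$P_{k+1}(z):=P_k(z)+z^{2^k}Q_k(z),\qquad Q_{k+1}(z):=P_k(z)-z^{2^k}Q_k(z),\qquad k=0,1,2,\ldots.$$ *)

(* Defs.v *)
From mathcomp Require Import all_boot all_order all_algebra.
From mathcomp Require Import complex.
From mathcomp Require Import reals.

Set Implicit Arguments.
Unset Strict Implicit.
Unset Printing Implicit Defensive.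

Import Order.TTheory GRing.Theory Num.Theory.
Local Open Scope ring_scope.

Fixpoint rudin_shapiro (A : nzRingType) (k : nat) : {poly A} * {poly A} :=
  if k is k'.+1 then
    let PQ := rudin_shapiro A k' in
    (PQ.1 + 'X^(2 ^ k') * PQ.2, PQ.1 - 'X^(2 ^ k') * PQ.2)
  else (1, 1).

Definition RSP (A : nzRingType) (k : nat) : {poly A} := (rudin_shapiro A k).1.
Definition RSQ (A : nzRingType) (k : nat) : {poly A} := (rudin_shapiro A k).2.

(* For p != 0, each zero is listed as often as its multiplicity; see
   count_mem_zeros. *)
Definition zeros (F : closedFieldType) (p : {poly F}) : seq F :=
  sval (closed_field_poly_normal p).

(* The zeros of p in A, counted with multiplicity, as is usual for
   polynomials. *)
Definition nb_zeros (F : closedFieldType) (A : pred F) (p : {poly F}) : nat :=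
  count A (zeros p).

(* The norm of R[i] has its values in R[i]; the order of R[i] restricts to the
   usual one on the image of R. *)
Definition annulus (R : realType) (r1 r2 : R) : pred R[i] :=
  fun z => (r1%:C)%C < `|z| < (r2%:C)%C.

Lemma zerosE (F : closedFieldType) (p : {poly F}) :
  p = lead_coef p *: \prod_(z <- zeros p) ('X - z%:P).
Proof. exact: svalP (closed_field_poly_normal p). Qed.

Lemma count_mem_zeros (F : closedFieldType) (p : {poly F}) (z : F) :
  p != 0 -> count_mem z (zeros p) = mup z p.
Proof.
move=> p0; rewrite {2}(zerosE p) -mul_polyC mupMr ?mu_prod_XsubC //.
by rewrite rootC lead_coef_eq0.
Qed.

Lemma size_RS (A : nzRingType) (k : nat) :
  size (RSP A k) = (2 ^ k)%N /\ size (RSQ A k) = (2 ^ k)%N.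
Proof.
rewrite /RSP /RSQ; elim: k => [|k [IHP IHQ]] /=; first by rewrite size_poly1.
have sXQ : size ('X^(2 ^ k) * (rudin_shapiro A k).2) = (2 ^ k.+1)%N.
  rewrite -commr_polyXn size_mulXn -?size_poly_eq0 IHQ -?lt0n ?expn_gt0 //.
  by rewrite expnS mul2n -addnn.
have ltP : (size (rudin_shapiro A k).1 < 2 ^ k.+1)%N.
  by rewrite IHP ltn_exp2l.
by rewrite addrC size_polyDl sXQ // addrC size_polyDl ?size_polyN sXQ.
Qed.

(* Main.v *)
(** Let z_a run over the n-th roots of unity, n = 2^k = 4M, and write
    |P_(k-2)|^2 = M + g and |Q_(k-2)|^2 = M - g on the unit circle. Since
    P_k(z_a) is 2 P_(k-2)(z_a) or, up to a unit, 2 Q_(k-2)(z_a) according to the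
    parity of a, the increment |P_k(z_(a+1))|^2 - |P_k(z_a)|^2 is
    -+ 4 (g(z_a) + g(z_(a+1))). As g has no frequency beyond n / 4 and mean
    square at least M^2 / 4, these increments are of order n in mean square
    (and likewise for Q_k).

    On the other hand, with z = z_1 and for every zero w,
    (z^2 u - w)(u - w) = (z u - w)^2 - u w (z - 1)^2, so that log |P_k| is
    almost convex along the grid at z u as soon as the sum of
    |w| |z - 1|^2 / |z u - w|^2 is small. Averaged over the grid and restricted
    to pairs with |z u - w| >= K / n, this sum is O(1 / K). Where log |P_k| is
    almost convex along 17 steps, a large increment would make |P_k| grow
    geometrically beyond the bound |P_k|^2 <= 2 n. Hence for a positive
    proportion of the grid points there is a zero within K / n, and each zero
    serves at most 2K grid points. *)

Require Import Defs.
From mathcomp Require Import all_boot all_order all_algebra.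
From mathcomp Require Import complex.
From mathcomp Require Import reals.
From mathcomp Require Import topology normedtype derive trigo.
From mathcomp Require Import ring lra zify.

Set Implicit Arguments.
Unset Strict Implicit.
Unset Printing Implicit Defensive.

Import Order.TTheory GRing.Theory Num.Theory.
Import numFieldNormedType.Exports.
Local Open Scope ring_scope.

(** * Mean square increments of Rudin-Shapiro polynomials *)

Lemma sum_geometric_unity_root (F : fieldType) n (x : F) :
  x ^+ n = 1 -> x != 1 -> \sum_(a < n) x ^+ a = 0.
Proof.
move=> xn x1; have := subrX1 x n; rewrite xn subrr => /esym/eqP.
by rewrite mulf_eq0 subr_eq0 (negPf x1) => /eqP.
Qed.

(** Orthogonality of characters: for [0 < i < n] the powers of [z ^+ i] sum to zero, so only the
    constant coefficient survives. *)
Lemma sum_horner_prim_root (F : fieldType) n (z : F) (p : {poly F}) :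
  n.-primitive_root z -> (size p <= n)%N ->
  \sum_(a < n) p.[z ^+ a] = n%:R * p`_0.
Proof.
move=> zP sp; have n0 := prim_order_gt0 zP.
under eq_bigr => a _ do rewrite (horner_coef_wide _ sp).
rewrite exchange_big /= (bigD1 (Ordinal n0)) //= [X in _ + X]big1 => [|i i0].
  rewrite addr0; under eq_bigr => a _ do rewrite expr0 mulr1.
  by rewrite sumr_const card_ord mulr_natl.
rewrite -mulr_sumr (eq_bigr (fun a : 'I_n => (z ^+ i) ^+ a)); last first.
  by move=> a _; rewrite -!exprM mulnC.
rewrite sum_geometric_unity_root ?mulr0 //.
  by rewrite exprAC (prim_expr_order zP) expr1n.
rewrite -(expr0 z) (eq_prim_root_expr zP) mod0n modn_small //.
Qed.

Section RootsOfUnity.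
Variable C : numClosedFieldType.
Implicit Types (z x y : C) (p : {poly C}).

Lemma norm_prim_root n z : n.-primitive_root z -> `|z| = 1.
Proof.
move=> zP; apply/eqP; rewrite -(pexpr_eq1 (prim_order_gt0 zP)) // -normrX.
by rewrite (prim_expr_order zP) normr1.
Qed.

Lemma parseval_prim_root n z p :
  n.-primitive_root z -> (size p <= n)%N ->
  \sum_(a < n) `|p.[z ^+ a]| ^+ 2 = n%:R * \sum_(i < n) `|p`_i| ^+ 2.
Proof.
move=> zP sp; have z1 := norm_prim_root zP.
have zz : z * z^* = 1 by rewrite -normCK z1 expr1n.
have zn0 : z != 0 by rewrite -normr_eq0 z1 oner_eq0.
have zV : z^* = z^-1 by apply: (mulfI zn0); rewrite zz divff.
under eq_bigr => a _.
  rewrite normCK (horner_coef_wide _ sp) raddf_sum /= big_distrlr /=.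
  over.
rewrite exchange_big mulr_sumr; apply: eq_bigr => i _.
rewrite exchange_big (bigD1 i) //= [X in _ + X]big1 => [|j ji].
  rewrite addr0 (eq_bigr (fun=> `|p`_i| ^+ 2)) => [|a _].
    by rewrite sumr_const card_ord mulr_natl.
  by rewrite -normCK normrM !normrX z1 !expr1n mulr1.
rewrite (eq_bigr (fun a : 'I_n => p`_i * (p`_j)^* * (z ^+ i / z ^+ j) ^+ a)).
  rewrite -mulr_sumr sum_geometric_unity_root ?mulr0 //.
    by rewrite exprMn exprVn !(exprAC _ _ n) (prim_expr_order zP) !expr1n divr1.
  apply: contra ji => /eqP e; have : z ^+ i == z ^+ j.
    by rewrite -subr_eq0 -{1}(divfK (expf_neq0 j zn0) (z ^+ i)) e mul1r subrr.
  by rewrite (eq_prim_root_expr zP) !modn_small // eq_sym => /eqP/val_inj->.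
move=> a _; rewrite rmorphM !rmorphXn /= zV mulrACA; congr (_ * _).
by rewrite exprMn !exprVn -!exprM !(mulnC a).
Qed.

(** The reciprocal polynomial: up to a power of the variable, it represents the conjugate of [p] on
    the unit circle by a polynomial. *)
Definition conj_reversal n p := \poly_(i < n) (p`_(n.-1 - i))^*.

Lemma horner_conj_reversal n p z : (size p <= n)%N -> `|z| = 1 ->
  z * (conj_reversal n p).[z] = z ^+ n * (p.[z])^*.
Proof.
case: n => [|n] sp z1.
  by move: sp; rewrite leqn0 size_poly_eq0 => /eqP->; rewrite horner_poly
    big_ord0 horner0 conjC0 !mulr0.
have zz : z * z^* = 1 by rewrite -normCK z1 expr1n.
rewrite horner_poly (horner_coef_wide _ sp) raddf_sum /= !mulr_sumr.
rewrite (reindex_inj rev_ord_inj); apply: eq_bigr => i _ /=.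
have in' : (i <= n)%N by rewrite -ltnS.
rewrite subSS (subKn in') rmorphM rmorphXn /=.
rewrite mulrCA -exprS -subSn // mulrCA; congr (_ * _).
have -> : z ^+ n.+1 = z ^+ (n.+1 - i) * z ^+ i.
  by rewrite -exprD subnK // ltnW.
by rewrite -mulrA -exprMn zz expr1n mulr1.
Qed.

Lemma horner_RSP_S k z :
  (RSP C k.+1).[z] = (RSP C k).[z] + z ^+ (2 ^ k) * (RSQ C k).[z].
Proof. by rewrite /RSP /RSQ /= !hornerE. Qed.

Lemma horner_RSQ_S k z :
  (RSQ C k.+1).[z] = (RSP C k).[z] - z ^+ (2 ^ k) * (RSQ C k).[z].
Proof. by rewrite /RSP /RSQ /= !hornerE. Qed.

Lemma normC2D x y :
  `|x + y| ^+ 2 = `|x| ^+ 2 + `|y| ^+ 2 + (x * y^* + (x * y^*)^*).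
Proof. by rewrite !normCK !rmorphM !rmorphD /= conjCK; ring. Qed.

(** By the parallelogram law the sum doubles at each level. *)
Lemma normC2_RS k z : `|z| = 1 ->
  `|(RSP C k).[z]| ^+ 2 + `|(RSQ C k).[z]| ^+ 2 = 2 * (2 ^ k)%:R.
Proof.
move=> z1; elim: k => [|k IH].
  by rewrite /RSP /RSQ /= !hornerE normr1 expr1n; ring.
rewrite horner_RSP_S horner_RSQ_S !normC2D normrN normrM normrX z1 expr1n mul1r.
rewrite rmorphN mulrN raddfN /= addrACA IH -opprD expnS natrM; ring.
Qed.

(** The function [g] of the overview, at level [k]. *)
Definition normC2_dev k z := `|(RSP C k).[z]| ^+ 2 - (2 ^ k)%:R.

Lemma normC2_RSP k z : `|(RSP C k).[z]| ^+ 2 = (2 ^ k)%:R + normC2_dev k z.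
Proof. by rewrite /normC2_dev; ring. Qed.

Lemma normC2_RSQ k z : `|z| = 1 ->
  `|(RSQ C k).[z]| ^+ 2 = (2 ^ k)%:R - normC2_dev k z.
Proof.
move=> z1; apply: (addrI (`|(RSP C k).[z]| ^+ 2)).
by rewrite normC2_RS // normC2_RSP; ring.
Qed.

Lemma normC2_devS k z : `|z| = 1 ->
  let h := z ^+ (2 ^ k) * (RSQ C k).[z] * ((RSP C k).[z])^* in
  normC2_dev k.+1 z = h + h^*.
Proof.
move=> z1 /=; rewrite /normC2_dev horner_RSP_S normC2D normrM normrX z1 expr1n.
rewrite mul1r normC2_RS // expnS natrM !rmorphM /= !conjCK; ring.
Qed.

(* The product [z^(2^k) Q_k(z) conj(P_k(z))] only involves the powers
   [z^1 .. z^(2^(k+1) - 1)], so that its square has mean zero. *)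
Lemma sum_normC2_devS n k z : n.-primitive_root z -> (4 * 2 ^ k <= n)%N ->
  \sum_(a < n) normC2_dev k.+1 (z ^+ a) ^+ 2 =
  2 * n%:R * (2 ^ k)%:R ^+ 2 - 2 * \sum_(a < n) normC2_dev k (z ^+ a) ^+ 2.
Proof.
move=> zP kn; have z1 := norm_prim_root zP.
have za a : `|z ^+ a| = 1 by rewrite normrX z1 expr1n.
have [sP sQ] := size_RS C k.
pose h w := w ^+ (2 ^ k) * (RSQ C k).[w] * ((RSP C k).[w])^*.
have sum_h : \sum_(a < n) h (z ^+ a) ^+ 2 = 0.
  (* On the unit circle ['X * q] takes the values of [h]. Its square has no constant term and size
     at most [4 * 2 ^ k], so the grid sum sees only a zero coefficient. *)
  pose q := RSQ C k * conj_reversal (2 ^ k) (RSP C k).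
  rewrite (eq_bigr (fun a : 'I_n => ('X^2 * q ^+ 2).[z ^+ a])) => [|a _].
    rewrite (sum_horner_prim_root zP) ?coefXnM ?mulr0 //.
    have sq : (size q <= (2 ^ k + 2 ^ k).-1)%N.
      apply: leq_trans (size_polyMleq _ _) _.
      by rewrite sQ -!subn1 leq_sub2r // leq_add2l size_poly.
    apply: leq_trans (leq_trans (size_polyMleq _ _) _) kn.
    rewrite size_polyXn expr2; have := size_polyMleq q q.
    have := expn_gt0 2 k; move: sq.
    move: (size (q * q)) (size q) (2 ^ k)%N; lia.
  have := horner_conj_reversal (eq_leq sP) (za a).
  rewrite /q hornerM hornerXn horner_exp hornerM -exprMn /h => e.
  by congr (_ ^+ 2); rewrite mulrCA e; ring.
(* Square [h + h^*]; the cross term is [2 |h|^2], where [|h|^2 = |P_k|^2 |Q_k|^2 = (2^k + g)(2^k -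
   g)]. *)
have e a : normC2_dev k.+1 (z ^+ a) ^+ 2 =
    h (z ^+ a) ^+ 2 + (h (z ^+ a) ^+ 2)^* +
    2 * ((2 ^ k)%:R ^+ 2 - normC2_dev k (z ^+ a) ^+ 2).
  rewrite normC2_devS // -/(h _) rmorphXn /=.
  have -> : (2 ^ k)%:R ^+ 2 - normC2_dev k (z ^+ a) ^+ 2 = `|h (z ^+ a)| ^+ 2.
    rewrite /h !normrM normrX za expr1n mul1r norm_conjC exprMn.
    by rewrite normC2_RSQ // normC2_RSP; ring.
  by rewrite normCK; ring.
under eq_bigr => a _ do rewrite e.
rewrite !big_split /= sum_h -raddf_sum sum_h raddf0 !add0r -mulr_sumr.
rewrite big_split sumrN sumr_const card_ord /= -mulr_natl; ring.
Qed.

(** Closed form of the recurrence [S_(k+1) = 2 n 4^k - 2 S_k] with [S_0 = 0]. *)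
Lemma sum_normC2_devE n k z : n.-primitive_root z -> (2 * 2 ^ k <= n)%N ->
  3 * \sum_(a < n) normC2_dev k (z ^+ a) ^+ 2 = n%:R * (4 ^+ k - (-2) ^+ k).
Proof.
move=> zP; elim: k => [|k IH] kn.
  rewrite subrr mulr0 big1 ?mulr0 // => a _.
  by rewrite /normC2_dev /RSP /= hornerE normr1 expr1n subrr expr0n.
move: kn; rewrite expnS mulnA => kn.
rewrite (sum_normC2_devS zP) // mulrBr (mulrCA _ 2) IH; last lia.
have -> : (2 ^ k)%:R ^+ 2 = 4 ^+ k :> C.
  by rewrite -natrX -expnM mulnC expnM natrX.
rewrite !exprS; ring.
Qed.

Lemma sum_normC2_dev_ge n k z : n.-primitive_root z -> (2 * 2 ^ k <= n)%N ->
  (0 < k)%N ->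
  n%:R * (2 ^ k)%:R ^+ 2 <= 4 * \sum_(a < n) normC2_dev k (z ^+ a) ^+ 2.
Proof.
move=> zP kn k0; rewrite -(ler_pM2l (ltr0n _ 3)) mulrCA [leRHS]mulrCA.
rewrite (sum_normC2_devE zP kn) [leRHS]mulrCA ler_wpM2l ?ler0n //.
have -> : (2 ^ k)%:R ^+ 2 = 4 ^+ k :> C.
  by rewrite -natrX -expnM mulnC expnM natrX.
(* What remains is [4 (-2)^k <= 4^k], which fails for [k = 0] and is an equality for [k = 2]. *)
rewrite mulrBr -subr_ge0 (_ : _ - _ = 4 ^+ k - 4 * (-2) ^+ k); last by ring.
case: k k0 {kn} => [//|[|k] _].
  by rewrite !expr1 mulrN opprK -natrM -natrD ler0n.
have -> : 4 ^+ k.+2 - 4 * (-2) ^+ k.+2 = 16 * (4 ^+ k - (-2) ^+ k) :> C.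
  by rewrite !exprS; ring.
rewrite mulr_ge0 // subr_ge0 (le_trans (real_ler_norm _)) //.
  by rewrite realX // realN realn.
by rewrite normrX normrN normr_nat lerXn2r ?nnegrE ?ler0n ?ler_nat.
Qed.

Lemma normC2_dev_real k z : normC2_dev k z \is Num.real.
Proof. by rewrite realB ?realn // realX ?normr_real. Qed.

(** For [|u| = 1], [|1 + u|^2 = 2 + 2 Re u]; here [u] is a power of [z] with exponent in [[-m, m]],
    and conjugation handles the negative exponents. *)
Lemma prim_root_normC2_1D n m z i : n.-primitive_root z ->
  (forall l, (l <= m)%N -> 0 <= 'Re (z ^+ l)) -> (i <= 2 * m)%N ->
  2 <= `|1 + z ^+ i / z ^+ m| ^+ 2.
Proof.
move=> zP Rez im; have z1 := norm_prim_root zP.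
have zn0 : z != 0 by rewrite -normr_eq0 z1 oner_eq0.
have Reu : 0 <= 'Re (z ^+ i / z ^+ m).
  have [mi|/ltnW mi] := leqP m i.
    by rewrite -expfB_cond ?(negPf zn0) // Rez //; lia.
  rewrite -[_ / _]invrK invf_div -expfB_cond ?(negPf zn0) // invC_norm.
  rewrite normrX z1 !expr1n invr1 mul1r Re_conj Rez //; lia.
rewrite normC2D normr1 mul1r normrM normfV !normrX z1 !expr1n invr1 mulr1.
rewrite -{1}[2]addr0 expr1n lerD //.
by rewrite conjCK addrC; move: Reu; rewrite ReE pmulr_lge0 // invr_gt0.
Qed.

(* [z^M (|P_m(z)|^2 - M)], with [M = 2^m], is a polynomial of degree less than
   [2 M]; the shift multiplies its coefficients by factors of modulus at least
   [sqrt 2], since only frequencies in [-M, M] occur. *)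
Lemma sum_normC2_dev_shift_ge m z : (4 * 2 ^ m).-primitive_root z ->
  (forall l, (l <= 2 ^ m)%N -> 0 <= 'Re (z ^+ l)) ->
  2 * \sum_(a < 4 * 2 ^ m) normC2_dev m (z ^+ a) ^+ 2 <=
  \sum_(a < 4 * 2 ^ m) (normC2_dev m (z ^+ a) + normC2_dev m (z ^+ a.+1)) ^+ 2.
Proof.
set M := (2 ^ m)%N; set n := (4 * M)%N => zP Rez; have z1 := norm_prim_root zP.
have M0 : (0 < M)%N by rewrite expn_gt0.
have za a : `|z ^+ a| = 1 by rewrite normrX z1 expr1n.
have zn0 : z != 0 by rewrite -normr_eq0 z1 oner_eq0.
have [sP _] := size_RS C m.
pose b := RSP C m * ('X * conj_reversal M (RSP C m)) - M%:R *: 'X^M.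
have bE w : `|w| = 1 -> b.[w] = w ^+ M * normC2_dev m w.
  move=> w1; rewrite /b hornerD hornerN hornerZ hornerXn !hornerM hornerX.
  rewrite (horner_conj_reversal (eq_leq sP) w1) /normC2_dev normCK -/M; ring.
have sb : (size b <= 2 * M)%N.
  rewrite (leq_trans (size_polyD _ _)) // geq_max size_polyN.
  rewrite (leq_trans (size_scale_leq _ _)) ?size_polyXn; last lia.
  have sX : (size ('X * conj_reversal M (RSP C m))%R <= M.+1)%N.
    rewrite (leq_trans (size_polyMleq _ _)) // size_polyX add2n.
    by rewrite ltnS size_poly.
  rewrite andbT (leq_trans (size_polyMleq _ _)) // sP -subn1 leq_subLR.
  by rewrite (leq_trans (leq_add (leqnn _) sX)) // -/M; lia.
(* Going from [z ^+ a] to [z ^+ a.+1], the prefactor of [b] gains [z ^+ M]. Dividing by it makes [s]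
   a unit times the sum of the two deviations. *)
pose c i := 1 + z ^+ i / z ^+ M.
pose s := \poly_(i < n) (b`_i * c i).
have sbn : (size b <= n)%N by rewrite (leq_trans sb) // /n; lia.
have sE a : `|s.[z ^+ a]| ^+ 2 =
    (normC2_dev m (z ^+ a) + normC2_dev m (z ^+ a.+1)) ^+ 2.
  suff -> : `|s.[z ^+ a]| = `|normC2_dev m (z ^+ a) + normC2_dev m (z ^+ a.+1)|.
    by rewrite real_normK // realD // normC2_dev_real.
  have -> : s.[z ^+ a] = b.[z ^+ a] + b.[z ^+ a.+1] / z ^+ M.
    rewrite horner_poly !(horner_coef_wide _ sbn) mulr_suml -big_split /=.
    apply: eq_bigr => i _; rewrite /c exprS exprMn; ring.
  rewrite !bE // exprS exprMn mulrAC [X in X / _]mulrC mulfK ?expf_neq0 //.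
  by rewrite -exprS -mulrDr normrM normrX za expr1n mul1r.
under [leRHS]eq_bigr => a _ do rewrite -sE.
rewrite (parseval_prim_root zP (size_poly _ _)).
have -> : \sum_(a < n) normC2_dev m (z ^+ a) ^+ 2 =
    \sum_(a < n) `|b.[z ^+ a]| ^+ 2.
  apply: eq_bigr => a _.
  by rewrite bE // normrM normrX za expr1n mul1r real_normK ?normC2_dev_real.
rewrite (parseval_prim_root zP sbn) mulrCA ler_wpM2l ?ler0n // mulr_sumr.
apply: ler_sum => i _; rewrite coef_poly ltn_ord normrM exprMn mulrC.
have [iM|Mi] := ltnP i (2 * M).
  by rewrite ler_wpM2l ?exprn_ge0 // (prim_root_normC2_1D zP) // ltnW.
by rewrite nth_default ?(leq_trans sb) // normr0 expr0n !mul0r.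
Qed.

(** With [x = P_m(w)], [y = w^(2^m) Q_m(w)] and a sign [s], the two values are [(x + y) + s (x - y)]
    and [(x + y) - s (x - y)], that is, [2 x] and [2 y] in some order. *)
Lemma normC2_RS_S2 m w (e : bool) : `|w| = 1 -> w ^+ (2 * 2 ^ m) = (-1) ^+ e ->
  `|(RSP C m.+2).[w]| ^+ 2 = 4 * ((2 ^ m)%:R + (-1) ^+ e * normC2_dev m w) /\
  `|(RSQ C m.+2).[w]| ^+ 2 = 4 * ((2 ^ m)%:R - (-1) ^+ e * normC2_dev m w).
Proof.
move=> w1 we; rewrite !(horner_RSP_S, horner_RSQ_S) expnS we.
set x := (RSP C m).[w]; set y := w ^+ (2 ^ m) * (RSQ C m).[w].
have xE : `|x| ^+ 2 = (2 ^ m)%:R + normC2_dev m w by rewrite normC2_RSP.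
have yE : `|y| ^+ 2 = (2 ^ m)%:R - normC2_dev m w.
  by rewrite /y normrM normrX w1 expr1n mul1r normC2_RSQ.
have n4 v : `|2 * v| ^+ 2 = 4 * `|v| ^+ 2.
  by rewrite normrM normr_nat exprMn -natrX.
case: e {we} => /=; rewrite ?expr1 ?expr0 ?mulN1r ?mul1r ?opprK -xE -yE -!n4.
  by split; congr (`|_| ^+ 2); ring.
by split; congr (`|_| ^+ 2); ring.
Qed.

Lemma prim_root_exp_half m z : (2 * m).-primitive_root z -> (0 < m)%N ->
  z ^+ m = -1.
Proof.
move=> zP m0; have /eqP : (z ^+ m) ^+ 2 = 1.
  by rewrite -exprM mulnC (prim_expr_order zP).
rewrite sqrf_eq1 => /orP[|/eqP//]; rewrite -(expr0 z) (eq_prim_root_expr zP).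
by rewrite mod0n modn_small; lia.
Qed.

(** The sign in front of the deviation alternates with [a], so increments become sums of
    neighbouring deviations. With [M = 2^m], the total is at least
    [16 * 2 * (n M^2 / 4) = n^3 / 2]. *)
Lemma sum_normC2_RS_diff_ge m z : (0 < m)%N -> (4 * 2 ^ m).-primitive_root z ->
  (forall l, (l <= 2 ^ m)%N -> 0 <= 'Re (z ^+ l)) ->
  let n := (4 * 2 ^ m)%N in
  forall p, p = RSP C m.+2 \/ p = RSQ C m.+2 ->
  n%:R ^+ 3 <=
  2 * \sum_(a < n) (`|p.[z ^+ a.+1]| ^+ 2 - `|p.[z ^+ a]| ^+ 2) ^+ 2.
Proof.
move=> m0 zP Rez /= p pE; have z1 := norm_prim_root zP.
have za a : `|z ^+ a| = 1 by rewrite normrX z1 expr1n.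
have zh a : (z ^+ a) ^+ (2 * 2 ^ m) = (-1) ^+ (odd a).
  rewrite exprAC (@prim_root_exp_half (2 * 2 ^ m)) ?signr_odd //.
    by rewrite mulnA.
  by rewrite muln_gt0 expn_gt0.
have dE a : (`|p.[z ^+ a.+1]| ^+ 2 - `|p.[z ^+ a]| ^+ 2) ^+ 2 =
    16 * (normC2_dev m (z ^+ a) + normC2_dev m (z ^+ a.+1)) ^+ 2.
  have [pa qa] := normC2_RS_S2 (za a) (zh a).
  have [pa1 qa1] := normC2_RS_S2 (za a.+1) (zh a.+1).
  by case: pE => ->; rewrite ?pa ?pa1 ?qa ?qa1 oddS; case: (odd a);
    rewrite ?expr0 ?expr1; ring.
under eq_bigr => a _ do rewrite dE.
rewrite -mulr_sumr.
have := sum_normC2_dev_shift_ge zP Rez.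
have := @sum_normC2_dev_ge _ m z zP.
rewrite leq_mul2r m0 orbT => /(_ isT isT).
move=> h1 h2.
have -> : (4 * 2 ^ m)%:R ^+ 3 = 16 * ((4 * 2 ^ m)%:R * (2 ^ m)%:R ^+ 2) :> C.
  by rewrite !natrM; ring.
rewrite [leRHS]mulrCA ler_wpM2l //; apply: le_trans h1 _.
by rewrite (natrM _ 2 2) -mulrA ler_wpM2l.
Qed.

End RootsOfUnity.

(** * Modulus and roots of unity in R[i] *)

Section Cabs.
Variable R : rcfType.
Implicit Types x y z : R[i].

(** The modulus as an element of [R], where real arithmetic applies. *)
Definition cabs z : R := complex.Re `|z|.

Lemma cabsE z : (cabs z)%:C%C = `|z|.
Proof. exact/RRe_real/normr_real. Qed.

Lemma cabs_ge0 z : 0 <= cabs z.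
Proof. by rewrite -lecR cabsE normr_ge0. Qed.

Lemma cabs_eq0 z : (cabs z == 0) = (z == 0).
Proof. by rewrite -(inj_eq (@complexI R)) cabsE normr_eq0. Qed.

Lemma cabs1 : cabs 1 = 1.
Proof. by apply: complexI; rewrite cabsE normr1. Qed.

Lemma cabsM x y : cabs (x * y) = cabs x * cabs y.
Proof. by apply: complexI; rewrite rmorphM /= !cabsE normrM. Qed.

Lemma cabsX z n : cabs (z ^+ n) = cabs z ^+ n.
Proof. by apply: complexI; rewrite rmorphXn /= !cabsE normrX. Qed.

Lemma cabs_prod I (r : seq I) (F : I -> R[i]) :
  cabs (\prod_(i <- r) F i) = \prod_(i <- r) cabs (F i).
Proof. exact: (big_morph cabs cabsM cabs1). Qed.

Lemma cabsN z : cabs (- z) = cabs z.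
Proof. by apply: complexI; rewrite !cabsE normrN. Qed.

Lemma cabsB x y : cabs (x - y) = cabs (y - x).
Proof. by rewrite -cabsN opprB. Qed.

Lemma ler_cabsD x y : cabs (x + y) <= cabs x + cabs y.
Proof. by rewrite -lecR rmorphD /= !cabsE ler_normD. Qed.

Lemma ler_cabsB x y : cabs x - cabs y <= cabs (x - y).
Proof. by rewrite lerBlDr -{1}(subrK y x) ler_cabsD. Qed.

Lemma sqr_cabs z : cabs z ^+ 2 = complex.Re z ^+ 2 + complex.Im z ^+ 2.
Proof. by apply: complexI; rewrite add_Re2_Im2 rmorphXn /= cabsE. Qed.

End Cabs.

Section Cis.
Variable R : realType.

Definition cis (t : R) : R[i] := (cos t +i* sin t)%C.

Lemma cisD s t : cis (s + t) = cis s * cis t.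
Proof. by rewrite /cis cosD sinD; congr (_ +i* _)%C; rewrite addrC. Qed.

Lemma cisX t n : cis t ^+ n = cis (n%:R * t).
Proof.
elim: n => [|n IH]; first by rewrite mul0r /cis cos0 sin0 expr0.
by rewrite exprS IH -cisD mulrSr mulrDl mul1r addrC.
Qed.

Lemma sqr_cabs_cisB1 t : cabs (cis t - 1) ^+ 2 = 2 - 2 * cos t.
Proof.
rewrite sqr_cabs /= subr0; have := cos2Dsin2 t.
move: (cos t) (sin t) => c s h; nra.
Qed.

Lemma cabs_cis t : cabs (cis t) = 1.
Proof.
apply/eqP; rewrite -(@pexpr_eq1 _ _ 2) ?cabs_ge0 // sqr_cabs /=.
by rewrite cos2Dsin2.
Qed.

Lemma sin_le (x : R) : 0 <= x -> sin x <= x.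
Proof.
move=> x0.
have [c _] := MVT_segment x0 (fun y _ => is_derive_sin y)
  (continuous_subspaceT (@continuous_sin R)).
by rewrite sin0 !subr0 => ->; rewrite ler_piMl // cos_le1.
Qed.

Definition cis_root n : R[i] := cis (2 * pi / n%:R).

Lemma cis_rootX n i : cis_root n ^+ i = cis (i%:R * (2 * pi / n%:R)).
Proof. exact: cisX. Qed.

Lemma cabs_cis_root n : cabs (cis_root n) = 1.
Proof. exact: cabs_cis. Qed.

Lemma cis_root_half n : (0 < n)%N -> cis_root (2 * n) ^+ n = -1.
Proof.
move=> n0; rewrite cis_rootX natrM.
rewrite (_ : _ * _ = pi); last by field; rewrite pnatr_eq0 -lt0n.
by rewrite /cis cospi sinpi -[in RHS](rmorph1 (real_complex R)) -rmorphN.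
Qed.

(** The order is a power of 2 dividing [2 ^ k.+1], and [z ^+ (2 ^ k) = -1] excludes the smaller
    ones. *)
Lemma cis_root_prim k : (2 ^ k.+1).-primitive_root (cis_root (2 ^ k.+1)).
Proof.
set z := cis_root _; have zh : z ^+ (2 ^ k) = -1.
  by rewrite /z expnS cis_root_half // expn_gt0.
have z1 : z ^+ (2 ^ k.+1) = 1 by rewrite expnSr exprM zh sqrrN expr1n.
have [m mP] := prim_order_exists (expn_gt0 2 k.+1) z1.
move=> /dvdn_pfactor[//|j jk mE]; move: jk; rewrite leq_eqVlt.
move=> /predU1P[<-|]; first by rewrite -mE.
rewrite ltnS => jk; have : z ^+ (2 ^ k) == 1.
  by rewrite -(prim_order_dvd mP) mE dvdn_exp2l.
by rewrite zh eq_sym -addr_eq0 -(natrD _ 1 1) pnatr_eq0.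
Qed.

Lemma Re_cis_root_ge0 n i : (4 * i <= n)%N ->
  0 <= 'Re (cis_root n ^+ i).
Proof.
move=> i4; rewrite -complexRe ler0c cis_rootX /=.
have [->|n0] := posnP n; first by rewrite invr0 !mulr0 cos0.
have pi0 : 0 < pi :> R := pi_gt0 R.
have n0' : 0 < n%:R :> R by rewrite ltr0n.
rewrite cos_ge0_pihalf //; apply/andP; split.
  apply: (@le_trans _ _ 0); first by rewrite oppr_le0 divr_ge0 ?ltW.
  by rewrite mulr_ge0 // divr_ge0 // mulr_ge0 // ltW.
rewrite mulrA ler_pdivrMr //.
have : 4 * i%:R <= n%:R :> R by rewrite -natrM ler_nat.
nra.
Qed.

Lemma cos_cis_root_le0 n i : (0 < n)%N -> (n <= 4 * i)%N -> (2 * i <= n)%N ->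
  cos (i%:R * (2 * pi / n%:R) : R) <= 0.
Proof.
move=> n0 n4 n2; rewrite -[_ * _](subrK pi) cosDpi oppr_le0.
have pi0 : 0 < pi :> R := pi_gt0 R.
have n0' : 0 < n%:R :> R by rewrite ltr0n.
have h4 : n%:R <= 4 * i%:R :> R by rewrite -natrM ler_nat.
have h2 : 2 * i%:R <= n%:R :> R by rewrite -natrM ler_nat.
rewrite (_ : i%:R * _ = (i%:R * 2 * pi) / n%:R); last by rewrite !mulrA.
rewrite cos_ge0_pihalf //; apply/andP; split.
  by rewrite lerBrDr ler_pdivlMr //; nra.
by rewrite lerBlDr ler_pdivrMr //; nra.
Qed.

(* [|z^2 - 1| <= 2 |z - 1|] brings the claim back to the exponents in
   [n/4, n/2], for which [Re z^i <= 0]. *)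
Lemma cabs_cis_rootX_ge n i : (2 * i <= n)%N ->
  2 * i%:R / n%:R <= cabs (cis_root n ^+ i - 1).
Proof.
have [->|n0] := posnP n; first by rewrite invr0 mulr0 cabs_ge0.
have n0' : 0 < n%:R :> R by rewrite ltr0n.
(* Doubling a positive [i] decreases [n - i], which makes the induction well founded. *)
have [m] := ubnP (n - i); elim: m i => // m IH i nim n2.
have [->|i0] := posnP i; first by rewrite mulr0 mul0r cabs_ge0.
have [n4|n4] := leqP n (4 * i).
  apply: (@le_trans _ _ 1).
    by rewrite ler_pdivrMr // mul1r -natrM ler_nat.
  rewrite -(@ler_pXn2r _ 2) ?nnegrE ?cabs_ge0 // expr1n.
  rewrite cis_rootX sqr_cabs_cisB1.
  by have := cos_cis_root_le0 n0 n4 n2; lra.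
have := IH (2 * i)%N; rewrite mulnA => /(_ _ (ltnW n4)).
have -> : cis_root n ^+ (2 * i) - 1 =
    (cis_root n ^+ i - 1) * (cis_root n ^+ i + 1).
  by rewrite mulnC exprM; ring.
rewrite cabsM => /(_ _)/le_trans h.
have {}h := h _ _ (ler_wpM2l (cabs_ge0 _) (ler_cabsD _ _)).
move: h; rewrite cabsX cabs_cis_root expr1n cabs1 natrM => h.
have := h ltac:(lia); rewrite -!mulrA; lra.
Qed.

(** The chord is [2 sin (pi / n)], and [pi < 4]. *)
Lemma cabs_cis_rootB1 n : (1 < n)%N -> cabs (cis_root n - 1) <= 8 / n%:R.
Proof.
move=> n1; have n0' : 0 < n%:R :> R by rewrite ltr0n ltnW.
have pi0 : 0 < pi :> R := pi_gt0 R.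
have pi4 : pi < 4 :> R by have := pihalf_lt2 R; lra.
rewrite -(@ler_pXn2r _ 2) ?nnegrE ?cabs_ge0 ?divr_ge0 // /cis_root.
rewrite sqr_cabs_cisB1 (_ : 2 * pi / _ = (pi / n%:R) *+ 2); last first.
  by rewrite -mulr_natl; ring.
rewrite cos_mulr2n cos2sin2.
have s0 : 0 <= sin (pi / n%:R : R).
  rewrite sin_ge0_pi //; apply/andP; split; first by rewrite divr_ge0 ?ltW.
  by rewrite ler_pdivrMr // ler_peMr ?ltW // ltr1n.
have s1 : sin (pi / n%:R : R) <= 4 / n%:R.
  apply: le_trans (sin_le _) _; first by rewrite divr_ge0 ?ltW.
  by rewrite ler_pM2r ?invr_gt0 // ltW.
move: s0 s1; rewrite (_ : 8 / _ = 2 * (4 / n%:R)); last by ring.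
move: (sin _) (4 / _) => s x; nra.
Qed.

End Cis.

(** * Distances from a point to the grid *)

Lemma sum_periodic (V : zmodType) n (F : nat -> V) j :
  (forall i, F (i + n)%N = F i) -> \sum_(i < n) F (i + j)%N = \sum_(i < n) F i.
Proof.
move=> Fn; elim: j => [|j IH]; first by apply: eq_bigr => i _; rewrite addn0.
rewrite -{}IH; case: n Fn => [|n] Fn; first by rewrite !big_ord0.
rewrite big_ord_recr big_ord_recl /= addrC.
rewrite (_ : (n + j.+1) = (0 + j) + n.+1)%N ?Fn; last lia.
by congr (_ + _); apply: eq_bigr => i _; congr F; rewrite /bump /=; lia.
Qed.

Lemma sum_ltn_leq n K : (\sum_(i < n) (i < K)%N <= K)%N.
Proof.
suff -> : (\sum_(i < n) (i < K) = minn n K)%N by apply: geq_minr.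
elim: n => [|n IH]; first by rewrite big_ord0 min0n.
by rewrite big_ord_recr /= IH; case: (ltnP n K) => h /=; lia.
Qed.

Lemma cis_root_expn (R : realType) n : (0 < n)%N -> cis_root R n ^+ n = 1.
Proof.
move=> n0; rewrite cis_rootX (_ : _ * _ = 2 * pi); last first.
  by field; rewrite pnatr_eq0 -lt0n.
by rewrite mulr_natl /cis cos2pi sin2pi.
Qed.

Section SpacedPoints.
Variable R : realType.
Variables (n : nat) (w : R[i]).
Hypothesis n1 : (1 < n)%N.
Let z a : R[i] := cis_root R n ^+ a.
Let dist a := cabs (z a - w).

Let n0 : 0 < n%:R :> R. Proof. by rewrite ltr0n ltnW. Qed.

Let cisn : cis_root R n ^+ n = 1.
Proof. exact/cis_root_expn/ltnW. Qed.

Let cabs_z a : cabs (z a) = 1.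
Proof. by rewrite cabsX cabs_cis_root expr1n. Qed.

Let dist_periodic a : dist (a + n) = dist a.
Proof. by rewrite /dist /z exprD cisn mulr1. Qed.

(** The minimum is the cyclic distance from [i] to 0; [z i] and [z (n - i)] are equally far from
    1. *)
Lemma cabs_cis_rootX_ge_min i : (i <= n)%N ->
  2 * (minn i (n - i))%:R / n%:R <= cabs (z i - 1).
Proof.
move=> ni; have [i2|i2] := leqP (2 * i) n.
  by rewrite (minn_idPl _) ?cabs_cis_rootX_ge //; lia.
rewrite (minn_idPr _); last lia.
have -> : z i - 1 = - (z i * (z (n - i) - 1)).
  by rewrite mulrBr -exprD subnKC // cisn; ring.
by rewrite cabsN cabsM cabs_z mul1r cabs_cis_rootX_ge //; lia.
Qed.

(* If [z b] is the grid point closest to [w], then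
   [|z (i + b) - z b| <= 2 |z (i + b) - w|]. *)
Lemma exists_closest_index : exists b, forall i, (i <= n)%N ->
  (minn i (n - i))%:R / n%:R <= dist (i + b).
Proof.
have := @arg_minP _ R _ (Ordinal (ltnW n1)) predT (fun b => dist b) isT.
case=> b _ bmin.
exists b => i ni.
have bi : dist b <= dist (i + b).
  have := bmin (Ordinal (ltn_pmod (i + b) (ltnW n1))) isT; rewrite /=.
  by rewrite /dist /z expr_mod.
rewrite -(ler_pM2l (ltr0n _ 2)) mulrA.
apply: le_trans (cabs_cis_rootX_ge_min ni) _.
have -> : cabs (z i - 1) = cabs ((z (i + b) - w) + (w - z b)).
  rewrite subrKA (_ : z (i + b) - z b = z b * (z i - 1)).
    by rewrite cabsM cabs_z mul1r.
  by rewrite /z exprD; ring.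
rewrite (le_trans (ler_cabsD _ _)) // (cabsB w) -/(dist b) -/(dist _).
by move: bi; lra.
Qed.

Variable K : nat.
Hypothesis K0 : (0 < K)%N.
Let kn : R := K%:R / n%:R.

(** A grid point has modulus 1, so one within [kn] of [w] forces [w] into the annulus. Near indices
    are then at cyclic distance less than [K] from the closest one. *)
Lemma count_near_indices : \sum_(a < n) (dist a < kn)%R%:R <=
  (2 * K)%:R * (1 - kn < cabs w < 1 + kn)%R%:R :> R.
Proof.
have [wA|wA] := boolP (_ < cabs w < _); last first.
  rewrite mulr0 big1 // => a _; case: ltP => // h.
  case/negP: wA; have := ler_cabsB (z a) w; have := ler_cabsB w (z a).
  by rewrite (cabsB w) -/(dist a) cabs_z; lra.
rewrite mulr1; have [b bP] := exists_closest_index.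
rewrite -(@sum_periodic _ _ (fun a => (dist a < kn)%R%:R) b) => [|i]; last first.
  by rewrite dist_periodic.
(* The weak inequality [n - i <= K] becomes exactly [i < K] under the reversal of ['I_n]. *)
apply: (@le_trans _ _ (\sum_(i < n) ((i < K)%N + (n - i <= K)%N)%:R)).
  apply: ler_sum => i _; case: ltP => // h; rewrite ler1n.
  have := le_lt_trans (bP i (ltnW (ltn_ord i))) h.
  by rewrite ltr_pM2r ?invr_gt0 // ltr_nat /minn; case: ifP; lia.
rewrite -natr_sum ler_nat big_split /= mul2n -addnn.
rewrite leq_add ?sum_ltn_leq // (reindex_inj rev_ord_inj) /=.
rewrite (eq_bigr (fun i : 'I_n => nat_of_bool (i < K)%N)) ?sum_ltn_leq //.
by move=> i _; rewrite subKn.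
Qed.

Let t j : R := (K + j)%:R ^- 2.

(** Telescoping: [1 / x^2 <= 2 / x - 2 / (x + 1)] for [x >= 1]. *)
Lemma sum_inv_sqr_le m : \sum_(i < m) t i <= 2 / K%:R.
Proof.
have Kj j : 0 < (K + j)%:R :> R by rewrite ltr0n addn_gt0 K0.
suff h : \sum_(i < m) t i <= 2 / (K + 0)%:R - 2 / (K + m)%:R.
  rewrite addn0 in h; apply: le_trans h _.
  by rewrite gerBl divr_ge0 ?ler0n.
elim: m => [|m IH]; first by rewrite big_ord0 subrr.
rewrite big_ord_recr /=; apply: le_trans (lerD IH (lexx _)) _.
have x1 : 1 <= (K + m)%:R :> R by rewrite ler1n addn_gt0 K0.
have k0 : 0 < K%:R :> R by rewrite ltr0n.
rewrite addn0 /t addnS -(@natr1 _ (K + m)%N).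
move: (K + m)%:R K%:R k0 x1 => x k k0 x1.
have x0 : 0 < x by apply: lt_le_trans x1.
rewrite -subr_ge0 (_ : _ - _ = (x - 1) / (x ^+ 2 * (x + 1))); last first.
  by field; rewrite !gt_eqF // addr_gt0.
by rewrite divr_ge0 ?subr_ge0 // mulr_ge0 ?exprn_ge0 ?addr_ge0 // ltW.
Qed.

(** Since [|w| <= 1 + d], each term is at most [1 / d^2 + 1 / d]. Averaging [d >= K / n] and
    [d >= m / n] gives [1 / d^2 <= 4 n^2 / (K + m)^2], and [1 / d <= n / K]. The sums contribute
    [16 n^2 / K] and [n^2 / K]. *)
Lemma sum_far_le :
  \sum_(a < n) (kn <= dist a)%R%:R * (cabs w / dist a ^+ 2) <=
  17 * n%:R ^+ 2 / K%:R.
Proof.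
have [b bP] := exists_closest_index.
have K0' : 0 < K%:R :> R by rewrite ltr0n.
have t0 j : 0 <= t j by rewrite invr_ge0 exprn_ge0.
rewrite -(@sum_periodic _ _
  (fun a => (kn <= dist a)%R%:R * (cabs w / dist a ^+ 2)) b) => [|i]; last first.
  by rewrite dist_periodic.
apply: (@le_trans _ _
  (\sum_(i < n) (4 * n%:R ^+ 2 * (t i + t (n - i)) + n%:R / K%:R))).
  apply: ler_sum => i _; have := bP i (ltnW (ltn_ord i)).
  have : cabs w <= 1 + dist (i + b).
    have := ler_cabsB w (z (i + b)).
    by rewrite (cabsB w) -/(dist _) cabs_z lerBlDr addrC.
  move: (dist _) => d wd; case: (leP kn d) => [kd|_ _]; last first.
    by rewrite mul0r addr_ge0 ?divr_ge0 // mulr_ge0 ?addr_ge0 // mulr_ge0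
       // exprn_ge0.
  rewrite mul1r; set m := minn _ _ => md.
  have d0 : 0 < d by apply: lt_le_trans kd; rewrite divr_gt0.
  have dV : d^-1 <= n%:R / K%:R.
    by rewrite -[n%:R / _]invf_div lef_pV2 // posrE divr_gt0.
  have dV2 : d ^- 2 <= 4 * n%:R ^+ 2 * t m.
    have Km : 0 < (K + m)%:R :> R by rewrite ltr0n addn_gt0 K0.
    have : ((2 * n%:R) / (K + m)%:R)^-1 <= d.
      by rewrite invf_div ler_pdivrMr ?mulr_gt0 // natrD; move: kd md;
        rewrite !ler_pdivrMr //; lra.
    have e0 : 0 < 2 * n%:R / (K + m)%:R :> R by rewrite divr_gt0 ?mulr_gt0.
    rewrite invf_ple ?posrE // => h.
    rewrite /t -!exprVn [X in X * _](_ : _ = (2 * n%:R) ^+ 2); last by ring.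
    by rewrite -exprMn lerXn2r // nnegrE ?invr_ge0 ltW.
  have tm : t m <= t i + t (n - i).
    by rewrite /m /minn; case: ifP => _; rewrite ?lerDl ?lerDr.
  apply: le_trans (ler_wpM2r _ wd) _; first by rewrite invr_ge0 exprn_ge0 // ltW.
  rewrite mulrDl mul1r (_ : d * _ = d^-1); last by field; rewrite gt_eqF.
  apply: lerD dV; apply: le_trans dV2 _.
  by rewrite ler_wpM2l // mulr_ge0 // exprn_ge0.
rewrite big_split /= -mulr_sumr big_split /= sumr_const card_ord.
rewrite -(mulr_natl (n%:R / K%:R)).
have t1 := sum_inv_sqr_le n.
have t2 : \sum_(i < n) t (n - i) <= 2 / K%:R.
  apply: le_trans (sum_inv_sqr_le n.+1); rewrite big_ord_recl /=.
  rewrite (reindex_inj rev_ord_inj) /= -[leLHS]add0r lerD //.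
  by rewrite le_eqVlt; apply/orP; left; apply/eqP/eq_bigr => i _; rewrite subKn.
have h : 4 * n%:R ^+ 2 * (\sum_(i < n) t i + \sum_(i < n) t (n - i)) <=
    4 * n%:R ^+ 2 * (2 / K%:R + 2 / K%:R).
  by rewrite ler_wpM2l ?lerD // mulr_ge0 // exprn_ge0.
apply: le_trans (lerD h (lexx _)) _.
by rewrite le_eqVlt; apply/orP; left; apply/eqP; field; rewrite gt_eqF.
Qed.

End SpacedPoints.

(** * Almost log-convexity away from the zeros *)

(** A weighted Weierstrass product inequality, [prod (1 - x_i) >= 1 - sum x_i], applied below with
    one factor per zero. *)
Lemma prod_ge_1Bsum (R : realFieldType) I (s : seq I) (f g x : I -> R) :
  (forall i, 0 <= f i) -> (forall i, 0 <= g i) -> (forall i, 0 <= x i) ->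
  (forall i, g i * (1 - x i) <= f i) ->
  (\prod_(i <- s) g i) * (1 - \sum_(i <- s) x i) <= \prod_(i <- s) f i.
Proof.
move=> f0 g0 x0 gf; elim: s => [|i s IH].
  by rewrite !big_nil subr0 mulr1.
rewrite !big_cons; move: (gf i) (f0 i) (g0 i) (x0 i).
have G0 : 0 <= \prod_(j <- s) g j by apply: prodr_ge0.
have F0 : 0 <= \prod_(j <- s) f j by apply: prodr_ge0.
have X0 : 0 <= \sum_(j <- s) x j by apply: sumr_ge0.
move: IH G0 F0 X0.
move: (\prod_(j <- s) g j) (\prod_(j <- s) f j) (\sum_(j <- s) x j).
move: (f i) (g i) (x i) => a b y B A Y AB B0 A0 Y0 ab a0 b0 y0.
have bB0 : 0 <= b * B by apply: mulr_ge0.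
have [Y1|Y1] := leP 1 (y + Y).
  apply: (@le_trans _ _ 0); last exact: mulr_ge0.
  by rewrite mulr_ge0_le0 // subr_le0.
apply: le_trans (ler_pM _ _ ab AB).
- rewrite mulrACA ler_wpM2l //; nra.
- by apply: mulr_ge0 => //; lra.
- by apply: mulr_ge0 => //; lra.
Qed.

(* Consecutive ratios of [y] start at 4/3 and decrease by at most 1/60 at each
   step, so that [y 9] would exceed [6/5 ^ 8 / 4 > 1]. *)
Lemma log_convex_increment_le (R : realFieldType) (y : nat -> R) :
  (forall i, 0 <= y i <= 1) ->
  (forall i, (i < 8)%N -> 0 < y i.+1) ->
  (forall i, (i < 8)%N -> 99 / 100 * y i.+1 ^+ 2 <= y i * y i.+2) ->
  y 1%N - y 0%N <= 1 / 4.
Proof.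
move=> y01 ypos ylc; rewrite leNgt; apply/negP => y1.
have y00 : 0 < y 0%N.
  have := ylc 0%N isT; have := ypos 0%N isT; have := ypos 1%N isT.
  have /andP[] := y01 0%N; move: (y 0%N) (y 1%N) (y 2%N) => a b c; nra.
have yp i : (i < 9)%N -> 0 < y i by case: i => // i; rewrite ltnS => /ypos.
have ratio i : (i <= 8)%N -> (4 / 3 - i%:R / 60) * y i <= y i.+1.
  elim: i => [_|i IH i8].
    (* As [y 1 <= 1], [y 0 < 3/4], so an increment above 1/4 exceeds a third of [y 0]. *)
    have /andP[_] := y01 1%N; move: y1; rewrite mul0r; lra.
  have := IH (ltnW i8); have := ylc i i8; have := ypos i i8.
  have := yp i (leqW i8); rewrite -(@natr1 _ i).
  have r0 : 0 <= i%:R :> R by [].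
  have r7 : i%:R <= 7 :> R by rewrite ler_nat.
  move: (y i) (y i.+1) (y i.+2) i%:R r0 r7 => a b c r r0 r7 a0 b0 abc h.
  rewrite -(ler_pM2l a0); apply: le_trans abc.
  (* The factor 99/100 costs the ratio at most 4/300, less than the allowed 1/60. *)
  have : 99 / 100 * (4 / 3 - r / 60) * a <= 99 / 100 * b by lra.
  move=> h1; have : (4 / 3 - (r + 1) / 60) * a <= 99 / 100 * b by nra.
  by move=> /(ler_wpM2r (ltW b0)) h2; lra.
have step i : (i < 8)%N -> 6 / 5 * y i.+1 <= y i.+2.
  move=> i8; apply: le_trans (ratio i.+1 i8); apply: ler_wpM2r.
    exact/ltW/ypos.
  have : i.+1%:R <= 8 :> R by rewrite ler_nat.
  lra.
have := (step 0 isT, step 1 isT, step 2 isT, step 3 isT)%N.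
have := (step 4 isT, step 5 isT, step 6 isT, step 7 isT)%N.
have /andP[_] := y01 9%N; have /andP[] := y01 0%N; move: y1.
move: (y 0%N) (y 1%N) (y 2%N) (y 3%N) (y 4%N) (y 5%N) (y 6%N) (y 7%N) (y 8%N).
move: (y 9%N) => y9 y0 y1 y2 y3 y4 y5 y6 y7 y8 h01 h0 _ h9.
move=> [[[s4 s5] s6] s7] [[[s0 s1] s2] s3]; lra.
Qed.

Section HornerModulus.
Variable R : realType.

Lemma cabs_hornerE (p : {poly R[i]}) u :
  cabs p.[u] = cabs (lead_coef p) * \prod_(w <- zeros p) cabs (u - w).
Proof.
rewrite {1}(zerosE p) hornerZ horner_prod cabsM cabs_prod; congr (_ * _).
by apply: eq_bigr => w _; rewrite hornerXsubC.
Qed.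

(* [(z^2 u - w) (u - w) = (z u - w)^2 - u w (z - 1)^2] for each zero [w]. *)
Lemma cabs_horner_log_convex (p : {poly R[i]}) (z u : R[i]) : cabs u = 1 ->
  cabs p.[z * u] ^+ 2 *
    (1 - cabs (z - 1) ^+ 2 *
         \sum_(w <- zeros p) cabs w / cabs (z * u - w) ^+ 2) <=
  cabs p.[u] * cabs p.[z ^+ 2 * u].
Proof.
move=> u1; rewrite !cabs_hornerE exprMn -prodrXl [leRHS]mulrACA -expr2.
rewrite -mulrA ler_wpM2l ?exprn_ge0 ?cabs_ge0 // -big_split /= mulr_sumr.
apply: prod_ge_1Bsum => w.
- by apply: mulr_ge0; apply: cabs_ge0.
- exact/exprn_ge0/cabs_ge0.
- apply: mulr_ge0; first exact/exprn_ge0/cabs_ge0.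
  by apply: divr_ge0; [apply: cabs_ge0 | apply/exprn_ge0/cabs_ge0].
(* If [z u] is the zero [w] itself, the left side vanishes whatever the quotient by 0 is. *)
have [->|d0] := eqVneq (cabs (z * u - w)) 0.
  by rewrite expr0n mul0r mulr_ge0 ?cabs_ge0.
rewrite mulrBr mulr1 mulrCA [_ * (cabs w / _)]mulrC divfK ?expf_neq0 //.
rewrite -!cabsX -!cabsM -[X in _ - X]mul1r -u1 -cabsM.
rewrite (_ : (u - w) * _ = (z * u - w) ^+ 2 - u * ((z - 1) ^+ 2 * w)).
  exact: ler_cabsB.
by ring.
Qed.

End HornerModulus.

(** * Counting zeros near the circle by averaging over the grid *)

Section ZerosNearCircle.
Variable R : realType.
Variables (n K : nat) (p : {poly R[i]}).
Hypothesis n1 : (1 < n)%N.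
Hypothesis K0 : (0 < K)%N.
Hypothesis p0 : p != 0.
Let kn : R := K%:R / n%:R.
Let z a : R[i] := cis_root R n ^+ a.
Let v a := cabs p.[z a].
Let delta2 : R := cabs (cis_root R n - 1) ^+ 2.

(* A value below 1 means that no zero lies within [K / n] of [z a] and that the
   correction to log-convexity in [cabs_horner_log_convex] is below 1/200. *)
Definition badness a : R := \sum_(w <- zeros p)
  ((cabs (z a - w) < kn)%R%:R + 200 * delta2 *
   ((kn <= cabs (z a - w))%R%:R * (cabs w / cabs (z a - w) ^+ 2))).

Let n_gt0 : (0 < n)%N := ltnW n1.

Let kn0 : 0 < kn. Proof. by rewrite divr_gt0 ?ltr0n. Qed.

Let cabs_z a : cabs (z a) = 1.
Proof. by rewrite cabsX cabs_cis_root expr1n. Qed.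

Let z_periodic a : z (a + n) = z a.
Proof. by rewrite /z exprD cis_root_expn ?mulr1. Qed.

Let badness_term_ge0 a w : 0 <= 200 * delta2 *
   ((kn <= cabs (z a - w))%R%:R * (cabs w / cabs (z a - w) ^+ 2)).
Proof.
apply: mulr_ge0; first by rewrite mulr_ge0 // exprn_ge0 ?cabs_ge0.
by rewrite mulr_ge0 // divr_ge0 ?exprn_ge0 ?cabs_ge0.
Qed.

Lemma badness_ge0 a : 0 <= badness a.
Proof. by apply: sumr_ge0 => w _; rewrite addr_ge0. Qed.

Lemma badness_lt1_log_convex a : badness a.+1 < 1 ->
  0 < v a.+1 /\ 99 / 100 * (v a.+1 ^+ 2) ^+ 2 <= v a ^+ 2 * v a.+2 ^+ 2.
Proof.
move=> bad1.
have far w : w \in zeros p -> kn <= cabs (z a.+1 - w).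
  move=> wp; rewrite leNgt; apply/negP => near.
  move: bad1; rewrite ltNge => /negP[].
  rewrite /badness (big_rem w) //= near -[leLHS]addr0 lerD //.
    by rewrite lerDl.
  by apply: sumr_ge0 => u _; rewrite addr_ge0.
have v0 b : 0 <= v b by apply: cabs_ge0.
have convex := @cabs_horner_log_convex R p (cis_root R n) (z a) (cabs_z a).
move: convex; rewrite -exprS -exprD !add2n -/(z _) -!/(v _) -/delta2.
set s := \sum_(w <- _) _ => convex.
have badE : badness a.+1 = 200 * delta2 * s.
  rewrite /badness mulr_sumr; apply: eq_big_seq => w /far wfar.
  by rewrite wfar ltNge wfar add0r mul1r.
have s1 : delta2 * s < 1 / 200 by move: bad1; rewrite badE; lra.
have lead0 : 0 < cabs (lead_coef p).
  by rewrite lt_def cabs_ge0 cabs_eq0 lead_coef_eq0 p0.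
split.
  rewrite /v cabs_hornerE mulr_gt0 // big_seq prodr_gt0 // => w /far.
  exact: lt_le_trans.
have x0 : 0 <= v a.+1 ^+ 2 by rewrite exprn_ge0.
have y0 : 0 <= v a * v a.+2 by rewrite mulr_ge0.
rewrite -exprMn; move: convex x0 y0 s1.
move: (v a.+1 ^+ 2) (v a * v a.+2) (delta2 * s) => x y u convex x0 y0 s1.
(* The constant 200 in [badness] is chosen so that [(199/200)^2 >= 99/100]. *)
have h : 199 / 200 * x <= y by nra.
have h2 : (199 / 200 * x) ^+ 2 <= y ^+ 2.
  by rewrite lerXn2r // nnegrE mulr_ge0 // divr_ge0.
apply: le_trans h2; rewrite exprMn ler_wpM2r ?exprn_ge0 //; lra.
Qed.

Hypothesis v_le : forall a, v a ^+ 2 <= 2 * n%:R.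

Let n0 : 0 < n%:R :> R. Proof. by rewrite ltr0n. Qed.

Let normalized_bounds a : 0 <= v a ^+ 2 / (2 * n%:R) <= 1.
Proof.
apply/andP; split; first by rewrite divr_ge0 ?exprn_ge0 ?cabs_ge0 ?mulr_ge0.
by rewrite ler_pdivrMr ?mulr_gt0 // mul1r v_le.
Qed.

Let normalized_log_convex a : badness a.+1 < 1 ->
  0 < v a.+1 ^+ 2 / (2 * n%:R) /\
  99 / 100 * (v a.+1 ^+ 2 / (2 * n%:R)) ^+ 2 <=
  v a ^+ 2 / (2 * n%:R) * (v a.+2 ^+ 2 / (2 * n%:R)).
Proof.
move=> /badness_lt1_log_convex[v0 vc]; split.
  by rewrite divr_gt0 ?exprn_gt0 ?mulr_gt0.
move: vc; move: (v a ^+ 2) (v a.+2 ^+ 2) (v a.+1 ^+ 2) (2 * n%:R)^-1 => x y u k.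
rewrite -subr_ge0 => h.
rewrite -subr_ge0 (_ : _ - _ = (x * y - 99 / 100 * u ^+ 2) * k ^+ 2).
  by rewrite mulr_ge0 // sqr_ge0.
by ring.
Qed.

(* Depending on its sign, the increment is controlled by the 8 points to the
   right or by the 8 points to the left of it. *)
Lemma sqr_increment_le b : (v (b + 9) ^+ 2 - v (b + 8) ^+ 2) ^+ 2 <=
  n%:R ^+ 2 / 4 + 4 * n%:R ^+ 2 * \sum_(i < 16) badness (b + i.+1).
Proof.
have S0 : 0 <= \sum_(i < 16) badness (b + i.+1).
  by apply: sumr_ge0 => i _; apply: badness_ge0.
have nn : 0 <= n%:R ^+ 2 :> R by rewrite exprn_ge0.
have [good|] := boolP [forall i : 'I_16, badness (b + i.+1) < 1]; last first.
  rewrite negb_forall => /existsP; case=> i; rewrite -leNgt => bad.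
  (* One bad point already pays for the trivial bound [(2 n)^2]. *)
  have S1 : 1 <= \sum_(i < 16) badness (b + i.+1).
    rewrite (bigD1 i) //= -[leLHS]addr0 lerD //.
    by apply: sumr_ge0 => j _; apply: badness_ge0.
  have := v_le (b + 9); have := v_le (b + 8).
  have := cabs_ge0 p.[z (b + 9)]; have := cabs_ge0 p.[z (b + 8)].
  rewrite -!/(v _) => a0 a1; have := exprn_ge0 2 a0; have := exprn_ge0 2 a1.
  move: (v (b + 9) ^+ 2) (v (b + 8) ^+ 2) => x y x0 y0 yn xn.
  apply: (@le_trans _ _ (4 * n%:R ^+ 2)); first by nra.
  by nra.
have {}good i : (i < 16)%N -> badness (b + i.+1) < 1.
  by move=> i16; have /forallP/(_ (Ordinal i16)) := good.
(* The run to the right uses badness at [b + 9] to [b + 16], the run to the left at [b + 8] down to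
   [b + 1]. *)
have up : v (b + 9) ^+ 2 / (2 * n%:R) - v (b + 8) ^+ 2 / (2 * n%:R) <= 1 / 4.
  pose y i := v (b + 8 + i) ^+ 2 / (2 * n%:R).
  have := @log_convex_increment_le _ y; rewrite /y addn0 -addnA; apply.
  - by move=> i; apply: normalized_bounds.
  - move=> i i8; rewrite (addnS (b + 8)); apply: (normalized_log_convex _).1.
    by rewrite -addnA -addnS good //; lia.
  - move=> i i8; rewrite !(addnS (b + 8)); apply: (normalized_log_convex _).2.
    by rewrite -addnA -addnS good //; lia.
have down : v (b + 8) ^+ 2 / (2 * n%:R) - v (b + 9) ^+ 2 / (2 * n%:R) <= 1 / 4.
  pose y i := v (b + 9 - i) ^+ 2 / (2 * n%:R).
  have := @log_convex_increment_le _ y; rewrite /y subn0 -addnBA //; apply.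
  - by move=> i; apply: normalized_bounds.
  - move=> i i8; rewrite (_ : b + 9 - i.+1 = (b + (7 - i)).+1)%N; last lia.
    by apply: (normalized_log_convex _).1; rewrite -addnS good //; lia.
  - move=> i i8; rewrite (_ : b + 9 - i.+1 = (b + (7 - i)).+1)%N; last lia.
    rewrite (_ : b + 9 - i.+2 = (b + (7 - i)))%N; last lia.
    rewrite (_ : b + 9 - i = (b + (7 - i)).+2)%N; last lia.
    rewrite [leRHS]mulrC.
    by apply: (normalized_log_convex _).2; rewrite -addnS good //; lia.
move: up down; rewrite -!mulrBl !ler_pdivrMr ?mulr_gt0 //.
move: (v (b + 9) ^+ 2) (v (b + 8) ^+ 2) => x y up down.
apply: (@le_trans _ _ (n%:R ^+ 2 / 4)); first by nra.
by rewrite lerDl mulr_ge0 // mulr_ge0.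
Qed.

(** Exchange the sums: a zero is near at most [2 K] grid points, and only if it is in the annulus;
    its far part is at most [200 * (64 / n^2) * (17 n^2 / K)]. *)
Lemma sum_badness_le : \sum_(a < n) badness a <=
  2 * K%:R * (nb_zeros (annulus (1 - kn) (1 + kn)) p)%:R +
  200 * 64 * 17 * (size (zeros p))%:R / K%:R.
Proof.
have delta_le : delta2 <= 64 / n%:R ^+ 2.
  rewrite /delta2 (_ : 64 / _ = (8 / n%:R) ^+ 2); last first.
    by field; rewrite gt_eqF.
  by rewrite lerXn2r ?nnegrE ?cabs_ge0 ?divr_ge0 // cabs_cis_rootB1.
have nbE : (nb_zeros (annulus (1 - kn) (1 + kn)) p)%:R =
    \sum_(w <- zeros p) (1 - kn < cabs w < 1 + kn)%R%:R :> R.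
  rewrite /nb_zeros -sum1_count big_mkcond natr_sum; apply: eq_bigr => w _ /=.
  by rewrite /annulus -cabsE !ltcR; case: ifP.
have -> : 200 * 64 * 17 * (size (zeros p))%:R / K%:R =
    \sum_(w <- zeros p) (200 * 64 * 17 / K%:R) :> R.
  by rewrite big_const_seq count_predT iter_addr_0 -mulr_natr; ring.
rewrite nbE mulr_sumr -big_split exchange_big /=; apply: ler_sum => w _.
rewrite big_split /= -mulr_sumr; apply: lerD.
  by have := count_near_indices w n1 K0; rewrite natrM.
have K0' : 0 < K%:R :> R by rewrite ltr0n.
rewrite -(mulrA 200 64 17) -[leLHS]mulrA -[leRHS]mulrA ler_wpM2l //.
apply: le_trans (ler_wpM2l (exprn_ge0 _ (cabs_ge0 _)) (sum_far_le w n1 K0)) _.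
have far0 : 0 <= 17 * n%:R ^+ 2 / K%:R :> R.
  by rewrite divr_ge0 // mulr_ge0 // exprn_ge0.
apply: le_trans (ler_wpM2r far0 delta_le) _.
rewrite le_eqVlt; apply/orP; left; apply/eqP; field.
by rewrite !gt_eqF.
Qed.

Hypothesis size_zeros_le : (size (zeros p) <= n)%N.
Hypothesis increments_ge :
  n%:R ^+ 3 <= 2 * \sum_(a < n) (v a.+1 ^+ 2 - v a ^+ 2) ^+ 2.
Hypothesis K_ge : 512 * (200 * 64 * 17) <= K%:R :> R.

(** With [B] the total badness and [N] the count, [n^3 <= 2 (n^3 / 4 + 64 n^2 B)] gives
    [n <= 256 B], while [B <= 2 K N + n / 512] by the choice of [K]; half of [n] is absorbed. *)
Lemma nb_zeros_annulus_ge :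
  n%:R <= 1024 * K%:R * (nb_zeros (annulus (1 - kn) (1 + kn)) p)%:R :> R.
Proof.
have badness_periodic a : badness (a + n) = badness a.
  by rewrite /badness z_periodic.
have v_periodic a : v (a + n) = v a by rewrite /v z_periodic.
have incr : \sum_(a < n) (v a.+1 ^+ 2 - v a ^+ 2) ^+ 2 <=
    n%:R * (n%:R ^+ 2 / 4) + 4 * n%:R ^+ 2 * (16 * \sum_(a < n) badness a).
  (* The shift by 8 centres each increment in its window of 16 badness values. *)
  rewrite -(@sum_periodic _ _ (fun a => (v a.+1 ^+ 2 - v a ^+ 2) ^+ 2) 8).
    apply: (@le_trans _ _ (\sum_(a < n) (n%:R ^+ 2 / 4 +
        4 * n%:R ^+ 2 * \sum_(i < 16) badness (a + i.+1)))).
      by apply: ler_sum => a _; rewrite -addnS sqr_increment_le.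
    rewrite big_split /= sumr_const card_ord -(mulr_natl (n%:R ^+ 2 / 4)) lerD //.
    rewrite -mulr_sumr exchange_big /= ler_wpM2l ?mulr_ge0 ?exprn_ge0 //.
    rewrite (eq_bigr (fun=> \sum_(a < n) badness a)) => [|i _].
      by rewrite sumr_const card_ord -(mulr_natl (\sum_(a < n) _)).
    exact: (@sum_periodic _ _ badness).
  by move=> a; rewrite -addSn !v_periodic.
have B := sum_badness_le.
have K0' : 0 < K%:R :> R by rewrite ltr0n.
have C : 200 * 64 * 17 * (size (zeros p))%:R / K%:R <= n%:R / 512 :> R.
  rewrite ler_pdivrMr //.
  have : (size (zeros p))%:R <= n%:R :> R by rewrite ler_nat.
  have : 0 <= (size (zeros p))%:R :> R by [].
  move: K_ge n0; move: (size _)%:R n%:R K%:R => s N k; nra.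
move: B C incr increments_ge; move: (\sum_(a < n) badness a) => B.
move: (_ / K%:R) (\sum_(a < n) _) => C S BC CN SB NS.
have h : n%:R ^+ 2 * n%:R <= n%:R ^+ 2 * (256 * B).
  by move: SB NS; rewrite exprS; lra.
have {h} : n%:R <= 256 * B by move: h; rewrite ler_pM2l // exprn_gt0.
lra.
Qed.

End ZerosNearCircle.

(** * Application to the Rudin-Shapiro polynomials *)

Lemma size_zeros (F : closedFieldType) (p : {poly F}) :
  p != 0 -> size (zeros p) = (size p).-1.
Proof.
move=> p0; rewrite [in RHS](zerosE p) size_scale ?lead_coef_eq0 //.
by rewrite size_prod_XsubC.
Qed.

Lemma nb_zeros_sub (F : closedFieldType) (A B : pred F) (p : {poly F}) :
  subpred A B -> (nb_zeros A p <= nb_zeros B p)%N.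
Proof. by move=> AB; apply: sub_count. Qed.

Section RudinShapiro.
Variable R : realType.

Lemma sub_annulus (r1 r2 s1 s2 : R) : s1 <= r1 -> r2 <= s2 ->
  subpred (annulus r1 r2) (annulus s1 s2).
Proof.
move=> sr rs w; rewrite /annulus -cabsE !ltcR => /andP[rw wr].
by rewrite (le_lt_trans sr) // (lt_le_trans wr).
Qed.

(** For [m = 0] the deviation vanishes identically on the circle, hence the restriction to
    [m > 0]. *)
Lemma nb_zeros_RS_annulus_ge (K m : nat) (p : {poly R[i]}) :
  (0 < K)%N -> (0 < m)%N -> 512 * (200 * 64 * 17) <= K%:R :> R ->
  p = RSP R[i] m.+2 \/ p = RSQ R[i] m.+2 ->
  let n := (2 ^ m.+2)%N in
  n%:R <= 1024 * K%:R *
    (nb_zeros (annulus (1 - K%:R / n%:R) (1 + K%:R / n%:R)) p)%:R :> R.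
Proof.
move=> K0 m0 Kbig pE /=; set n := (2 ^ m.+2)%N.
have nE : n = (4 * 2 ^ m)%N by rewrite /n !expnS mulnA.
have sp : size p = n by have [sP sQ] := size_RS R[i] m.+2; case: pE => ->.
have n1 : (1 < n)%N by rewrite nE; have := expn_gt0 2 m; lia.
have p0 : p != 0 by rewrite -size_poly_eq0 sp -lt0n ltnW.
have prim : (4 * 2 ^ m).-primitive_root (cis_root R n).
  by rewrite -nE; apply: cis_root_prim.
apply: nb_zeros_annulus_ge => //.
- move=> a; rewrite -lecR rmorphXn /= cabsE rmorphM /= !rmorph_nat.
  have := @normC2_RS R[i] m.+2 (cis_root R n ^+ a).
  rewrite -cabsE cabsX cabs_cis_root expr1n => /(_ erefl) <-.
  by case: pE => ->; rewrite ?lerDl ?lerDr exprn_ge0.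
- by rewrite size_zeros // sp leq_pred.
- rewrite -lecR rmorphXn rmorphM /= rmorph_sum /= !rmorph_nat.
  under [in leRHS]eq_bigr => a _ do
    rewrite rmorphXn rmorphB !rmorphXn /= !cabsE.
  have := sum_normC2_RS_diff_ge m0 prim _ pE; rewrite -nE; apply => l l4.
  by apply: Re_cis_root_ge0; rewrite nE leq_mul2l.
Qed.


(** Serves the small indices [k <= 2], which the averaging argument leaves out. *)
Lemma zeros_bounded (s : seq {poly R[i]}) :
  exists2 b : R, 0 <= b & forall p w, p \in s -> w \in zeros p -> cabs w <= b.
Proof.
exists (\sum_(p <- s) \sum_(w <- zeros p) cabs w) => [|p w ps wp].
  by apply: sumr_ge0 => p _; apply: sumr_ge0 => w _; apply: cabs_ge0.
rewrite (big_rem p) //= (big_rem w) //= -addrA lerDl.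
apply: addr_ge0; apply: sumr_ge0 => q _; first exact: cabs_ge0.
by apply: sumr_ge0 => u _; apply: cabs_ge0.
Qed.

Lemma nb_zeros_annulus_all (r1 r2 : R) (p : {poly R[i]}) : r1 < 0 ->
  (forall w, w \in zeros p -> cabs w < r2) ->
  nb_zeros (annulus r1 r2) p = size (zeros p).
Proof.
move=> r10 wr2; apply/eqP; rewrite -all_count; apply/allP => w /wr2 wr.
by rewrite /annulus -cabsE !ltcR wr andbT (lt_le_trans r10) // cabs_ge0.
Qed.

End RudinShapiro.

Theorem theorem2p7 (R : realType) :
  exists c1 c2 : R, [/\ 0 < c1, 0 < c2 &
    forall k : nat, (1 <= k)%N ->
      let n : nat := (2 ^ k)%N in
      let A : pred R[i] := annulus (1 - c1 / n%:R) (1 + c1 / n%:R) in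
      c2 * n%:R <= (nb_zeros A (RSP R[i] k))%:R /\
      c2 * n%:R <= (nb_zeros A (RSQ R[i] k))%:R].
Proof.
pose K := Num.bound (512 * (200 * 64 * 17) : R).
have Kbig : 512 * (200 * 64 * 17) <= K%:R :> R.
  by apply/ltW/archi_boundP; rewrite !mulr_ge0.
have K1 : 1 <= K%:R :> R by apply: le_trans Kbig; lra.
have K0 : (0 < K)%N by rewrite -(ltr_nat R); apply: lt_le_trans K1.
have [b b0 bP] := zeros_bounded
  [:: RSP R[i] 1; RSQ R[i] 1; RSP R[i] 2; RSQ R[i] 2].
(* The term [4 * (1 + b)] puts all zeros in the annulus when [k <= 2]. *)
pose c1 := K%:R + 4 * (1 + b); pose c2 : R := (1024 * K%:R)^-1.
have c20 : 0 < c2 by rewrite invr_gt0 mulr_gt0 // (lt_le_trans ltr01).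
exists c1, c2; split=> // [|k k1 n A]; first by rewrite /c1; lra.
suff main p : p = RSP R[i] k \/ p = RSQ R[i] k ->
    c2 * n%:R <= (nb_zeros A p)%:R by split; apply: main; [left | right].
have n0 : 0 < n%:R :> R by rewrite ltr0n expn_gt0.
have [k3|k3] := leqP 3 k => pE.
  have k2 : (k - 2).+2 = k by lia.
  have := @nb_zeros_RS_annulus_ge R K (k - 2) p K0 _ Kbig.
  rewrite k2 => /(_ _ pE) h; rewrite mulrC ler_pdivrMr; last first.
    by rewrite mulr_gt0 // (lt_le_trans ltr01).
  rewrite mulrC; apply: le_trans (h _) _; first lia.
  rewrite ler_wpM2l ?mulr_ge0 // ler_nat.
  have c1n : K%:R / n%:R <= c1 / n%:R.
    by rewrite ler_pM2r ?invr_gt0 // lerDl mulr_ge0 // addr_ge0.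
  by apply/nb_zeros_sub/sub_annulus; rewrite ?lerD2l ?lerN2.
have nk : n%:R <= 4 :> R.
  by rewrite ler_nat (leq_pexp2l (isT : 0 < 2)%N (k3 : k <= 2)%N).
have sp : size p = n by have [sP sQ] := size_RS R[i] k; case: pE => ->.
have p0 : p != 0 by rewrite -size_poly_eq0 sp expn_eq0.
(* As [n <= 4 < c1], the inner radius is negative; as [c1 / n >= 1 + b], the outer one exceeds the
   modulus of every zero. *)
rewrite nb_zeros_annulus_all => [||w wp]; last 2 first.
- rewrite subr_lt0 ltr_pdivlMr // mul1r /c1; lra.
- apply: (@le_lt_trans _ _ b).
    apply: bP wp; rewrite !inE.
    by case: k k1 k3 {n A n0 nk sp} pE => [|[|[|]]] // _ _ [] ->;
      rewrite eqxx ?orbT.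
  have : b < c1 / n%:R by rewrite ltr_pdivlMr // /c1; nra.
  lra.
rewrite size_zeros // sp.
have n2 : (2 <= n)%N by rewrite (leq_pexp2l (isT : 0 < 2)%N k1).
(* All [n - 1] zeros count, and [n - 1 >= n / 2], so [c2 <= 1 / 2] suffices. *)
have : (n%:R : R) <= 2 * n.-1%:R by rewrite -natrM ler_nat; lia.
have c21 : c2 <= 1 / 2.
  by rewrite div1r lef_pV2 ?posrE ?mulr_gt0 ?(lt_le_trans ltr01) //; lra.
move: n0 c20; move: n%:R n.-1%:R => x y; nra.
Qed.
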